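(* Let $R$ be a ring, let $M$ be a projective right $R$-module, and let $E:=\operatorname{End}_R(M)$. If $M$ has finite length, then $E_E$ has finite length, with $\ell(E_E)\leq \ell(M_R)$. Moreover (still assuming $M$ has finite length), if $M$ is a faithfully projective $R$-module, then $\ell(E_E)=\ell(M_R)$; conversely, if $\ell(E_E)=\ell(M_R)$, then $M$ is slightly compressible.
   Context: Rings are unital with $1\neq 0$; modules are right unital modules. $\ell(\cdot)$ denotes the length of a composition series, and $E_E$ is $E$ as a right module over itself. A right $R$-module $M$ is faithfully projective if the functor $\operatorname{Hom}_R(M,-)$ is faithfully exact, i.e., a sequence $A\to B\to C$ of right $R$-modules is exact if and only if the induced sequence $\operatorname{Hom}_R(M,A)\to\operatorname{Hom}_R(M,B)\to\operatorname{Hom}_R(M,C)$ is exact; equivalently, $M$ is projective and $\operatorname{Hom}_R(M,A)\neq 0$ for every nonzero right $R$-module $A$. A (nonzero) module $M$ is slightly compressible (also called retractable) if $\operatorname{Hom}_R(M,N)\neq 0$ for every nonzero submodule $N$ of $M$. *)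

(* Defs.v *)
From HB Require Import structures.
From mathcomp Require Import all_boot all_order all_algebra.
From mathcomp Require Import boolp classical_sets.

Set Implicit Arguments.
Unset Strict Implicit.
Unset Printing Implicit Defensive.

Import GRing.Theory.
Local Open Scope classical_set_scope.
Local Open Scope ring_scope.

(* MathComp modules are left modules, so a right R-module is a module over    *)
(* the converse ring R^c, with m r written r *: m. The base ring is only      *)
(* required to be a pzRingType, because the endomorphism ring of the zero     *)
(* module is trivial.                                                         *)
Notation rmodType R := (lmodType R^c).

Section Submodules.
Variables (R : pzRingType) (M : rmodType R).

Record submod := Submod {
  submod_set :> set M;
  submodP : submod_closed [in submod_set] }.

Variable N : submod.

Definition in_submod : {pred M} := [in submod_set N].

Fact in_submod_closed : submod_closed in_submod.
Proof. exact: submodP. Qed.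

HB.instance Definition _ :=
  GRing.isSubmodClosed.Build R^c M in_submod in_submod_closed.

Definition submod_type := {x : M | in_submod x}.

HB.instance Definition _ := [isSub of submod_type for @sval _ _].
HB.instance Definition _ := [Choice of submod_type by <:].
HB.instance Definition _ := [SubChoice_isSubLmodule of submod_type by <:].

End Submodules.

(* [composition_series N n] : 0 = N 0 < N 1 < ... < N n = M is a chain of     *)
(* submodules in which each term is maximal in the next one; the values N i   *)
(* with i > n are irrelevant.                                                 *)
Definition composition_series (R : pzRingType) (M : rmodType R)
    (N : nat -> submod M) (n : nat) : Prop :=
  [/\ N 0%N = [set 0] :> set M,
      N n = setT :> set M &
      forall i, (i < n)%N ->
        N i `<` N i.+1 /\ ~ exists K : submod M, N i `<` K /\ K `<` N i.+1].

Definition composition_length (R : pzRingType) (M : rmodType R) : set nat :=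
  [set n | exists N : nat -> submod M, composition_series N n].

Definition finite_length (R : pzRingType) (M : rmodType R) : Prop :=
  exists n, composition_length M n.

(* The length of some composition series (of any one, by Jordan-Hoelder).     *)
(* The value is meaningful only under [finite_length M].                      *)
Definition module_length (R : pzRingType) (M : rmodType R) : nat :=
  xget 0%N (composition_length M).

Section modHom.
Variables (R : pzRingType) (A B : rmodType R).

Definition modHom := {linear A -> B}.

HB.instance Definition _ := gen_eqMixin modHom.
HB.instance Definition _ := gen_choiceMixin modHom.

Lemma modHomP (f g : modHom) : f =1 g -> f = g.
Proof.
case: f g => [f [[fD] [fZ]]] [g [[gD] [gZ]]] /= /funext fg; subst g.
by rewrite (Prop_irrelevance fD gD) (Prop_irrelevance fZ gZ).
Qed.

Definition modHom_zero : modHom := \0.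
Definition modHom_opp (f : modHom) : modHom := \- f.
Definition modHom_add (f g : modHom) : modHom := f \+ g.

Fact modHom_addA : associative modHom_add.
Proof. by move=> f g h; apply: modHomP => x /=; rewrite addrA. Qed.
Fact modHom_addC : commutative modHom_add.
Proof. by move=> f g; apply: modHomP => x /=; rewrite addrC. Qed.
Fact modHom_add0 : left_id modHom_zero modHom_add.
Proof. by move=> f; apply: modHomP => x /=; rewrite add0r. Qed.
Fact modHom_addN : left_inverse modHom_zero modHom_opp modHom_add.
Proof. by move=> f; apply: modHomP => x /=; rewrite addNr. Qed.

HB.instance Definition _ :=
  GRing.isZmodule.Build modHom modHom_addA modHom_addC modHom_add0 modHom_addN.

End modHom.

Section modEnd.
Variables (R : pzRingType) (M : rmodType R).

Definition modEnd := modHom M M.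

HB.instance Definition _ := GRing.Zmodule.on modEnd.

Definition modEnd_one : modEnd := idfun.
Definition modEnd_mul (f g : modEnd) : modEnd := f \o g.

Fact modEnd_mulA : associative modEnd_mul.
Proof. by move=> f g h; apply: modHomP. Qed.
Fact modEnd_mul1l : left_id modEnd_one modEnd_mul.
Proof. by move=> f; apply: modHomP. Qed.
Fact modEnd_mul1r : right_id modEnd_one modEnd_mul.
Proof. by move=> f; apply: modHomP. Qed.
Fact modEnd_mulDl : left_distributive modEnd_mul +%R.
Proof. by move=> f g h; apply: modHomP. Qed.
Fact modEnd_mulDr : right_distributive modEnd_mul +%R.
Proof. by move=> f g h; apply: modHomP => x; exact: linearD. Qed.

HB.instance Definition _ := GRing.Zmodule_isPzRing.Build modEnd
  modEnd_mulA modEnd_mul1l modEnd_mul1r modEnd_mulDl modEnd_mulDr.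

End modEnd.

Definition regular_rmod (E : pzRingType) : rmodType E := (E^c)^o.

Lemma regular_rmodE (E : pzRingType) (a : E) (x : regular_rmod E) :
  (a : E^c) *: x = (x : E) * a.
Proof. by []. Qed.

Definition projective (R : pzRingType) (M : rmodType R) : Prop :=
  forall (A B : rmodType R) (g : modHom A B) (f : modHom M B),
    range g = setT -> exists h : modHom M A, g \o h =1 f.

Definition exact_at (X Y : Type) (Z : zmodType) (f : X -> Y) (g : Y -> Z) :
  Prop := range f = g @^-1` [set 0].

Definition modHom_map (R : pzRingType) (M A B : rmodType R) (f : modHom A B) :
  modHom M A -> modHom M B := fun h => f \o h.

Definition faithfully_projective (R : pzRingType) (M : rmodType R) : Prop :=
  forall (A B C : rmodType R) (f : modHom A B) (g : modHom B C),
    exact_at f g <-> exact_at (@modHom_map R M A B f) (@modHom_map R M B C g).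

(* The notion is used for nonzero M; the zero module satisfies it vacuously.  *)
Definition slightly_compressible (R : pzRingType) (M : rmodType R) : Prop :=
  forall N : submod M, N <> [set 0] :> set M ->
    exists h : modHom M (submod_type N), h <> 0.

(* Main.v *)
(* For a submodule N let H(N) = Hom(M, N), a right ideal of E. If K is maximal *)
(* in L then, by projectivity, H(K) is equal to or maximal in H(L):           *)
(* if f is in H(L) but not in H(K) then L = K + f(M), so lifting g in H(L)    *)
(* along M + K -> L gives g in f E + H(K). Hence H turns a composition series *)
(* of M into one of E with possible repetitions. If M is faithfully           *)
(* projective there are none, by faithful exactness at K -> L -> 0. If N is a *)
(* nonzero submodule with H(N) = 0, apply H to the chain N + W i, for a       *)
(* composition series W of M: it goes from 0 to E and has a repetition        *)
(* because N + W i does, so l(E) < l(M).                                      *)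

Require Import Defs.
From HB Require Import structures.
From mathcomp Require Import all_boot all_order all_algebra.
From mathcomp Require Import boolp classical_sets.

Set Implicit Arguments.
Unset Strict Implicit.
Unset Printing Implicit Defensive.

Import GRing.Theory.
Local Open Scope classical_set_scope.
Local Open Scope ring_scope.

(* The map N -> Hom(M, N), here [hom_ideal], sends chains of submodules of M to chains of right
   ideals of E. Projectivity turns each composition step into a step or an equality
   ([hom_ideal_covers]), and [composition_length_compress] deletes the equalities, giving l(E) <=
   l(M). Faithfulness forbids equalities ([faithfully_projective_hom_ideal]), while a nonzero N with
   Hom(M, N) = 0 forces one ([composition_series_join_proper]). That [module_length] does not depend
   on the series rests on [composition_series_leq]. *)
#[local] Identity Coercion fun_of_set : set >-> Funclass.

(** * Lattice of submodules, covering steps and composition length *)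

Section SubmodLattice.
Variables (R : pzRingType) (M : rmodType R).
Implicit Types (K L N : submod M) (A : set M).

Lemma submod_eq K L : K = L :> set M -> K = L.
Proof.
case: K L => [A cA] [B cB] /= AB; subst B.
by rewrite (Prop_irrelevance cA cB).
Qed.

Lemma submod_proper K L : K `<=` L -> K <> L -> K `<` L.
Proof.
move=> KL neqKL; split=> // LK; apply/neqKL/submod_eq.
by apply/seteqP; split.
Qed.

Lemma submod0 N : N 0.
Proof. by case: (submodP N) => /set_mem. Qed.

Lemma submod_lin N a u v : N u -> N v -> N (a *: u + v).
Proof.
by case: (submodP N) => _ cN Nu Nv; apply: set_mem; apply: cN; apply: mem_set.
Qed.

Lemma submodB N u v : N u -> N v -> N (u - v).
Proof.
by move=> Nu Nv; rewrite addrC -scaleN1r; apply: submod_lin.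
Qed.

Lemma submodD N u v : N u -> N v -> N (u + v).
Proof.
by move=> Nu Nv; rewrite -[u]scale1r; apply: submod_lin.
Qed.

Lemma submod_closed_set A : A 0 ->
  (forall a u v, A u -> A v -> A (a *: u + v)) -> submod_closed [in A].
Proof.
move=> A0 cA; split=> [|a u v /set_mem Au /set_mem Av]; apply: mem_set => //.
exact: cA.
Qed.

Definition submod_of A (A0 : A 0)
    (cA : forall a u v, A u -> A v -> A (a *: u + v)) : submod M :=
  Submod (submod_closed_set A0 cA).

Definition meet_submod K L : submod M.
Proof.
apply: (@submod_of (K `&` L)); first by split; apply: submod0.
by move=> a u v [Ku Lu] [Kv Lv]; split; apply: submod_lin.
Defined.

Definition join_submod K L : submod M.
Proof.
apply: (@submod_of [set x | exists u v, [/\ K u, L v & x = u + v]]).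
  by exists 0, 0; split; rewrite ?addr0 //; apply: submod0.
move=> a _ _ [u [v [Ku Lv ->]]] [u' [v' [Ku' Lv' ->]]].
exists (a *: u + u'), (a *: v + v'); split; try exact: submod_lin.
by rewrite scalerDr addrACA.
Defined.

Lemma join_subr K L : L `<=` join_submod K L.
Proof.
by move=> x Lx; exists 0, x; rewrite add0r; split=> //; apply: submod0.
Qed.

Lemma join_subl K L : K `<=` join_submod K L.
Proof.
by move=> x Kx; exists x, 0; rewrite addr0; split=> //; apply: submod0.
Qed.

Lemma join_sub K L N : K `<=` N -> L `<=` N -> join_submod K L `<=` N.
Proof.
by move=> KN LN _ [u [v [/KN Nu /LN Nv ->]]]; apply: submodD.
Qed.

(** This is literally the step condition of [composition_series], so the two are interchangeable by
    conversion. *)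
Definition covers K L : Prop :=
  K `<` L /\ ~ exists N : submod M, K `<` N /\ N `<` L.

Lemma covers_max K L N : covers K L -> K `<` N -> N `<=` L -> N = L.
Proof.
move=> [_ noN] KN NL; apply: contrapT => NneL; apply: noN; exists N.
by split=> //; apply: submod_proper.
Qed.

Lemma covers_join_elim K L N x : covers K L -> N `<=` L -> N x -> ~ K x ->
  join_submod K N = L.
Proof.
move=> KL NL Nx nKx; apply: (covers_max KL); last first.
  by apply: join_sub NL => //; case: KL => -[].
split=> [|/(_ x)]; first exact: join_subl.
by move=> /(_ (@join_subr K N x Nx)).
Qed.

(** If P lies strictly between N + K and N + L, some element of P outside N + K has an L-component v
    outside K. Since N is inside P, v lies in P, so maximality of K gives L = K + (P meet L), which
    is inside P. *)
Lemma covers_join K L N : covers K L ->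
  join_submod N K = join_submod N L \/
  covers (join_submod N K) (join_submod N L).
Proof.
move=> KL; have [[KsubL _] _] := KL.
have NKL : join_submod N K `<=` join_submod N L.
  by apply: join_sub; [apply: join_subl | move=> x /KsubL; apply: join_subr].
have [eqj|neqj] := pselect (join_submod N K = join_submod N L); first by left.
right; split.
  exact: submod_proper.
move=> [P [[sub1 nsub1] [sub2 nsub2]]]; apply: nsub2.
have /existsNP[p /not_implyP[Pp npNK]] := nsub1.
have [u [v [Nu Lv puv]]] := sub2 _ Pp.
have NP : N `<=` P by move=> z Nz; apply/sub1/join_subl.
have Pv : P v.
  have -> : v = p - u by rewrite puv addrC addKr.
  by apply: submodB => //; apply: NP.
have nKv : ~ K v by move=> Kv; apply: npNK; exists u, v.
apply: join_sub => //.
have QL : meet_submod P L `<=` L by move=> ? [].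
rewrite -(@covers_join_elim K L (meet_submod P L) v KL QL (conj Pv Lv) nKv).
apply: join_sub => [z Kz|z []//]; exact/sub1/join_subr.
Qed.

(** Deleting the repetitions of W leaves a composition series; its length is still n only if nothing
    was deleted. *)
Lemma composition_length_compress (W : nat -> submod M) n :
  W 0 = [set 0] :> set M -> W n = setT :> set M ->
  (forall i, (i < n)%N -> W i = W i.+1 \/ covers (W i) (W i.+1)) ->
  exists m, [/\ composition_length M m, (m <= n)%N &
    m = n -> forall i, (i < n)%N -> W i <> W i.+1].
Proof.
move=> W0 WT Wstep.
suff [C [m [C0 Cm Cstep lemn strict]]] : exists C : nat -> submod M, exists m,
    [/\ C 0%N = W 0%N, C m = W n,
      forall i, (i < m)%N -> covers (C i) (C i.+1), (m <= n)%N &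
      m = n -> forall i, (i < n)%N -> W i <> W i.+1].
  exists m; split=> //; exists C; split=> //; first by rewrite C0.
  by rewrite Cm.
elim: n Wstep {WT} => [|n IHn] Wstep; first by exists W, 0%N; split.
have [|C [m [C0 Cm Cstep lemn strict]]] := IHn.
  by move=> i ltin; apply/Wstep/ltnW.
have [eqW|covW] := Wstep n (leqnn _).
  exists C, m; split; rewrite -?eqW ?(leqW lemn) // => eqm.
  by rewrite eqm ltnn in lemn.
(* The compressed chain ends at [C m = W n], so [W n.+1] is appended as its new top. *)
exists (fun i => if (i <= m)%N then C i else W n.+1), m.+1; split=> //.
- by rewrite ltnn.
- move=> i; rewrite ltnS => leim; rewrite leim.
  have [ltim|leqmi] := ltnP i m; first exact: Cstep.
  have -> : i = m by apply/eqP; rewrite eqn_leq leim.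
  by rewrite Cm.
- move=> [eqmn] i; rewrite ltnS leq_eqVlt => /predU1P[->|ltin].
    move=> e; case: covW => -[_ nsub] _; apply: nsub.
    by rewrite -e.
  exact: strict.
Qed.

(* The length of L, read off from the trace on L of a composition series N of *)
(* M. Being strictly monotone in L, it bounds the length of any chain, which  *)
(* gives the part of the Jordan-Hoelder theorem needed here.                  *)
Definition trace_length (N : nat -> submod M) n L : nat :=
  (\sum_(i < n) `[< ~ meet_submod L (N i.+1) `<=` N i >])%N.

(** If the lengths agreed, the traces of K and L would jump at the same indices. At a jump, N i.+1 =
    N i + (K meet N i.+1), so an element of L in N i.+1 can be corrected by one of K to fall into N
    i; by induction L would be inside K. *)
Lemma trace_length_proper (N : nat -> submod M) n K L :
  composition_series N n -> K `<` L ->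
  (trace_length N n K < trace_length N n L)%N.
Proof.
move=> [N0 NT Nstep] [KL nLK]; rewrite ltn_neqAle.
have le_trace i :
    (`[< ~ meet_submod K (N i.+1) `<=` N i >] <=
     `[< ~ meet_submod L (N i.+1) `<=` N i >])%N.
  case: asboolP => // nK; case: asboolP => // /contrapT Li; case: nK.
  by move=> x [Kx Nx]; apply: Li; split=> //; apply: KL.
apply/andP; split; last by apply: leq_sum => i _; apply: le_trace.
apply/eqP => eqt; apply: nLK.
have eq_trace (i : 'I_n) : `[< ~ meet_submod K (N i.+1) `<=` N i >] =
                 `[< ~ meet_submod L (N i.+1) `<=` N i >] :> nat.
  have := leqif_sum (fun (i : 'I_n) (_ : xpredT i) => leqif_eq (le_trace i)).
  move=> [_]; rewrite -!/(trace_length _ _ _) eqt eqxx.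
  by move=> /esym/forallP/(_ i)/eqP.
suff sub i : (i <= n)%N -> meet_submod L (N i) `<=` K.
  by move=> x Lx; apply: (sub n (leqnn n)); split; rewrite // NT.
elim: i => [_ x [_]|i IHi ltin x [Lx Nx]].
  by rewrite N0 => ->; apply: submod0.
have {}IHi := IHi (ltnW ltin).
have [Li|] := pselect (meet_submod L (N i.+1) `<=` N i).
  by apply: IHi; split=> //; apply: Li.
move=> nL; have := eq_trace (Ordinal ltin); rewrite /= [in RHS]asboolT //.
case: asboolP => // /existsNP[y /not_implyP[[Ky Ny] nNy]] _.
have QN : meet_submod K (N i.+1) `<=` N i.+1 by move=> ? [].
move: (Nx); rewrite -(covers_join_elim (Nstep i ltin) QN (conj Ky Ny) nNy).
move=> [u [v [Nu [Kv Nv] xuv]]]; rewrite xuv; apply: submodD => //.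
apply: IHi; split=> //; have -> : u = x - v by rewrite xuv addrK.
by apply: submodB => //; apply: KL.
Qed.

Lemma composition_series_leq (N K : nat -> submod M) n k :
  composition_series N n -> composition_series K k -> (k <= n)%N.
Proof.
move=> serN [_ _ Kstep].
apply: (@leq_trans (trace_length N n (K k))); last first.
  rewrite -[leqRHS](card_ord n) -sum1_card.
  by apply: leq_sum => i _; apply: leq_b1.
suff le_i i : (i <= k)%N -> (i <= trace_length N n (K i))%N by exact: le_i.
elim: i => // i IHi ltik; apply: leq_ltn_trans (IHi (ltnW ltik)) _.
by apply: trace_length_proper => //; case: (Kstep i ltik).
Qed.

Lemma module_lengthE n : composition_length M n -> module_length M = n.
Proof.
move=> serN; have [N Nn] := serN.
have [K Kn] : composition_length M (module_length M) by exact: xgetI serN.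
by apply/eqP; rewrite eqn_leq (composition_series_leq Nn Kn)
  (composition_series_leq Kn Nn).
Qed.

End SubmodLattice.

(** * Maps with values in a submodule *)

Section Corestriction.
Variables (R : pzRingType) (A M : rmodType R) (N : submod M).

Fact corestr_subproof (f : A -> M) (fN : forall x, N (f x)) x :
  in_submod N (f x).
Proof. exact: mem_set. Qed.

Definition corestr_fun (f : modHom A M) (fN : forall x, N (f x)) (x : A) :
  submod_type N := exist _ (f x) (corestr_subproof fN x).

Fact corestr_linear f fN : linear (@corestr_fun f fN).
Proof. by move=> a u v; apply: val_inj; rewrite /= !linearP. Qed.

Definition corestr f fN : modHom A (submod_type N) :=
  HB.pack (@corestr_fun f fN)
    (GRing.isLinear.Build _ _ _ _ _ (@corestr_linear f fN)).

Definition incl : modHom (submod_type N) M := \val.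

Lemma submod_typeP (x : submod_type N) : N (val x).
Proof. exact/set_mem/(valP x). Qed.

End Corestriction.

(** * The right ideals Hom(M, N) of the endomorphism ring *)

Section HomIdeal.
Variables (R : pzRingType) (M : rmodType R).
Local Notation E := (modEnd M).
Implicit Types (K L N : submod M).

(** In [regular_rmod E] the scalar multiple [a *: f] computes to [f \o a], whose values are values
    of f; hence closure under the right action. *)
Definition hom_ideal N : submod (regular_rmod E).
Proof.
apply: (@submod_of _ (regular_rmod E)
          [set f : regular_rmod E | forall x, N ((f : E) x)]).
  by move=> x; apply: submod0.
by move=> a f g Nf Ng x; apply: (@submodD _ _ N); [apply: Nf | apply: Ng].
Defined.

Lemma hom_idealT N : N = setT :> set M -> hom_ideal N = setT :> set _.
Proof. by move=> NT; apply/seteqP; split=> // f _ x; rewrite NT. Qed.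

(** The hypothesis is the vanishing of Hom(M, N) rather than of N, because the last claim of the
    theorem needs it for a nonzero N. *)
Lemma hom_ideal0 N : (forall f : E, (forall x, N (f x)) -> f = 0) ->
  hom_ideal N = [set 0] :> set _.
Proof.
move=> N0; apply/seteqP; split=> f /=; first exact: N0.
by move=> -> x; apply: submod0.
Qed.

(** The map (x, u) -> u + f x from the direct sum of M and K onto L is surjective, so g lifts along
    it; h is the M-component of the lift, and the K-component is g - f h. *)
Lemma projective_lift (f g : E) K L : projective M ->
  (forall x, L (f x)) -> (forall x, L (g x)) ->
  (forall y, L y -> exists u x, K u /\ y = u + f x) -> K `<=` L ->
  exists h : E, forall x, K (g x - f (h x)).
Proof.
move=> projM fL gL surj KL.
pose A : rmodType R := (M * submod_type K)%type.
pose s_fun (p : A) : M := val p.2 + f p.1.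
have s_lin : linear s_fun.
  move=> a p q; rewrite /s_fun /= !linearP /= scalerDr.
  by rewrite addrACA.
pose s : modHom A M := HB.pack s_fun (GRing.isLinear.Build _ _ _ _ _ s_lin).
have sL p : L (s p) by apply: submodD => //; apply/KL/submod_typeP.
have [|h hE] := projM A (submod_type L) (corestr sL) (corestr gL).
  apply/seteqP; split=> // y _; have [u [x [Ku yE]]] := surj _ (submod_typeP y).
  exists (x, exist _ u (mem_set Ku) : submod_type K) => //.
  by apply: val_inj; rewrite /= yE.
pose p1 : modHom A M := @fst M (submod_type K).
exists (p1 \o h : modHom M M) => x.
have /(congr1 val) /= <- := hE x.
by rewrite addrK; apply: submod_typeP.
Qed.

Lemma hom_ideal_covers K L : projective M -> covers K L ->
  hom_ideal K = hom_ideal L \/ covers (hom_ideal K) (hom_ideal L).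
Proof.
move=> projM KL; have [[KsubL _] _] := KL.
have HKL : hom_ideal K `<=` hom_ideal L by move=> f Kf x; apply/KsubL/Kf.
have [eqH|neqH] := pselect (hom_ideal K = hom_ideal L); first by left.
right; split.
  exact: submod_proper.
move=> [J [[HKJ nJHK] [JHL nHLJ]]]; apply: nHLJ => g Lg.
have /existsNP[f /not_implyP[Jf /existsNP[x nKfx]]] := nJHK.
have Lf := JHL _ Jf.
have cf : submod_closed [in range (f : E)].
  apply: submod_closed_set; first by exists 0; rewrite ?linear0.
  move=> a _ _ [u _ <-] [v _ <-]; exists (a *: u + v) => //.
  by rewrite linearP.
have fL : Submod cf `<=` L by move=> _ [y _ <-]; apply: Lf.
have joinE := covers_join_elim KL fL (ex_intro2 _ _ x I erefl) nKfx.
have [|h hE] := projective_lift projM Lf Lg _ KsubL.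
  move=> y; rewrite -joinE => -[u [_ [Ku [z _ <-] ->]]]; by exists u, z.
(* The first summand is f h, in J since J is a right ideal; the second lies in Hom(M, K), which J
   contains. *)
have -> : g = (h : E^c) *: f + (g - (h : E^c) *: f) by rewrite addrC subrK.
by apply: submod_lin => //; apply: HKJ.
Qed.

Lemma composition_length_hom (W : nat -> submod M) n : projective M ->
  (forall f : E, (forall x, W 0%N (f x)) -> f = 0) -> W n = setT :> set M ->
  (forall i, (i < n)%N -> W i = W i.+1 \/ covers (W i) (W i.+1)) ->
  exists m, [/\ composition_length (regular_rmod E) m, (m <= n)%N &
    m = n -> forall i, (i < n)%N -> hom_ideal (W i) <> hom_ideal (W i.+1)].
Proof.
move=> projM W0 WT Wstep.
apply: (@composition_length_compress _ _ (hom_ideal \o W)).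
- exact: hom_ideal0.
- exact: hom_idealT.
- by move=> i /Wstep[/= ->|]; [left | apply: hom_ideal_covers].
Qed.

(** If Hom(M, K) = Hom(M, L), then Hom(M, -) makes K -> L -> 0 exact, so the inclusion of K in L is
    onto. The zero endomorphism of L stands in for the map L -> 0. *)
Lemma faithfully_projective_hom_ideal K L : faithfully_projective M ->
  K `<` L -> hom_ideal K <> hom_ideal L.
Proof.
move=> faithM [KL nLK] eqH; apply: nLK.
have incK (x : submod_type K) : L (@incl _ _ K x) by apply/KL/submod_typeP.
pose z : modHom (submod_type L) (submod_type L) := 0.
have [_ exKL] := faithM _ _ _ (corestr incK) z.
have exK : exact_at (corestr incK) z.
  apply: exKL; apply/seteqP; split=> h /= => [_|_].
    by apply: modHomP.
  pose g : E := @incl _ _ L \o h.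
  have Kg : hom_ideal K g by rewrite eqH => x; apply: submod_typeP.
  exists (corestr Kg) => //; apply: modHomP => x; exact: val_inj.
move=> y Ly; have : z (exist _ y (mem_set Ly)) = 0 by [].
rewrite -[_ = 0]/((z @^-1` [set 0]) _) -exK => -[u _ /(congr1 val) /= <-].
exact: submod_typeP.
Qed.

(** At the first i where N meets W i.+1 outside 0, it does so outside W i, hence W i.+1 = W i + (N
    meet W i.+1) and N + W i = N + W i.+1, a repetition. *)
Lemma composition_series_join_proper (W : nat -> submod M) n N :
  composition_series W n ->
  (forall i, (i < n)%N -> join_submod N (W i) <> join_submod N (W i.+1)) ->
  N = [set 0] :> set M.
Proof.
move=> [W0 WT Wstep] strict.
suff sub i : (i <= n)%N -> meet_submod N (W i) `<=` [set 0].
  apply/seteqP; split=> x => [Nx|->]; last exact: submod0.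
  by apply: (sub n) => //; split; rewrite // WT.
elim: i => [_ x []|i IHi ltin x [Nx Wx]]; first by rewrite W0.
have {}IHi := IHi (ltnW ltin).
apply: contrapT => x0; have nWx : ~ W i x by move=> Wix; apply/x0/IHi.
have [[WW _] _] := Wstep i ltin.
have QW : meet_submod N (W i.+1) `<=` W i.+1 by move=> ? [].
have joinE := covers_join_elim (Wstep i ltin) QW (conj Nx Wx) nWx.
apply: (strict i ltin); apply/submod_eq/seteqP; split.
  by apply: join_sub; [apply: join_subl | move=> z /WW; apply: join_subr].
apply: join_sub; first exact: join_subl.
rewrite -joinE; apply: join_sub; first exact: join_subr.
by move=> z [Nz _]; apply: join_subl.
Qed.

End HomIdeal.

Theorem theorem3p8 (R : nzRingType) (M : rmodType R) :
  projective M -> finite_length M ->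
  [/\ finite_length (regular_rmod (modEnd M)) /\
        (module_length (regular_rmod (modEnd M)) <= module_length M)%N,
      faithfully_projective M ->
        module_length (regular_rmod (modEnd M)) = module_length M &
      module_length (regular_rmod (modEnd M)) = module_length M ->
        slightly_compressible M].
Proof.
move=> projM [n serW]; have [W Wn] := serW; rewrite (module_lengthE serW).
have [W0 WT Wstep] := Wn.
have H0 (f : modEnd M) : (forall x, W 0%N (f x)) -> f = 0.
  by rewrite W0 => f0; apply: modHomP.
split.
- have [m [serE lemn _]] :=
    composition_length_hom projM H0 WT (fun i lti => or_intror (Wstep i lti)).
  by rewrite (module_lengthE serE); split=> //; exists m.
- move=> faithM; apply: module_lengthE.
  exists (@hom_ideal _ M \o W); split=> [||i ltin].
  + exact: hom_ideal0.
  + exact: hom_idealT.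
  + have [eqH|//] := hom_ideal_covers projM (Wstep i ltin).
    by case: (faithfully_projective_hom_ideal faithM (Wstep i ltin).1).
- move=> lenE N N0; apply: contrapT => noh; apply: N0.
  (* A repetition N + W i = N + W i.+1 is also one under Hom(M, -). Its chain starts at Hom(M, N) =
     0 and ends at E, so compressing it makes l(E) < n, against [lenE]. *)
  apply: (composition_series_join_proper Wn) => i ltin eqj.
  have [||| m [serE _ strict]] :=
      @composition_length_hom _ M (fun i => join_submod N (W i)) n projM.
  + move=> f fN; have {}fN x : N (f x).
      by have [u [v [Nu]]] := fN x; rewrite W0 => -> ->; rewrite addr0.
    apply: contrapT => f0; apply: noh; exists (corestr fN) => /= c0; apply: f0.
    apply: modHomP => x.
    exact: (congr1 (fun h : modHom M (submod_type N) => val (h x)) c0).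
  + by apply/seteqP; split=> // x _; apply: join_subr; rewrite WT.
  + by move=> j ltjn; apply/covers_join/Wstep.
  + by apply: (strict _ i ltin); rewrite ?eqj // -lenE (module_lengthE serE).
Qed.
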